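(* Let $(U,\tau,A)$ and $(V,\tau',B)$ be soft topological spaces, let $u:U\to V$ and $p:A\to B$ be mappings, and suppose that the induced mapping $f_{pu}:SS(U)_A\to SS(V)_B$ is surjective and soft $pu$-continuous. If $(U,\tau,A)$ is soft connected, then $(V,\tau',B)$ is soft connected.
   Context: Let $X$ be a set and $E$ a set of parameters. A soft set $(F,E)$ over $X$ is a map $F:E\to\mathcal{P}(X)$; $SS(X)_E$ is the family of all of them. Unions and intersections are taken parameterwise. $\Phi_E$ is the null soft set $e\mapsto\emptyset$, and $\widetilde{X}$ is the soft set $e\mapsto X$. A soft topological space $(X,\tau,E)$ is given by a family $\tau\subseteq SS(X)_E$ containing $\Phi_E$ and $\widetilde{X}$ and closed under arbitrary unions and finite intersections; members of $\tau$ are called soft open. A soft separation of $\widetilde{X}$ is a pair of soft open sets, both different from $\Phi_E$, whose union is $\widetilde{X}$ and whose intersection is $\Phi_E$. The space is soft connected if no soft separation of $\widetilde{X}$ exists. Given $u:U\to V$ and $p:A\to B$, the mapping $f_{pu}:SS(U)_A\to SS(V)_B$ sends $(F,A)$ to the soft set $(f_{pu}(F),B)$ with $f_{pu}(F)(y)=\bigcup_{x\in p^{-1}(y)}u(F(x))$ for $y\in B$ (which is $\emptyset$ if $p^{-1}(y)=\emptyset$). The inverse image of $(G,B)\in SS(V)_B$ is the soft set $f_{pu}^{-1}(G,B)=(f_{pu}^{-1}(G),A)$ with $f_{pu}^{-1}(G)(x)=u^{-1}(G(p(x)))$ for $x\in A$. The mapping $f_{pu}$ is soft $pu$-continuous if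 $f_{pu}^{-1}(G,B)\in\tau$ for every $(G,B)\in\tau'$. *)

(* Defs.v *)
From mathcomp Require Import all_boot.
From mathcomp Require Import boolp classical_sets functions cardinality.
Set Implicit Arguments.
Unset Strict Implicit.
Unset Printing Implicit Defensive.

Local Open Scope classical_set_scope.

Definition soft_set (X E : Type) : Type := E -> set X.

Definition soft_null {X E : Type} : soft_set X E := fun _ => set0.

Definition soft_full {X E : Type} : soft_set X E := fun _ => setT.

Definition soft_setU {X E : Type} (F G : soft_set X E) : soft_set X E :=
  fun e => F e `|` G e.

Definition soft_setI {X E : Type} (F G : soft_set X E) : soft_set X E :=
  fun e => F e `&` G e.

Definition soft_bigcup {X E : Type} (S : set (soft_set X E)) : soft_set X E :=
  fun e => \bigcup_(F in S) F e.

Definition soft_bigcap {X E : Type} (S : set (soft_set X E)) : soft_set X E :=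
  fun e => \bigcap_(F in S) F e.

Record soft_topology {X E : Type} (tau : set (soft_set X E)) : Prop :=
  SoftTopology {
    soft_open_null : tau soft_null ;
    soft_open_full : tau soft_full ;
    soft_open_bigcup : forall S : set (soft_set X E),
      S `<=` tau -> tau (soft_bigcup S) ;
    soft_open_bigcap : forall S : set (soft_set X E),
      finite_set S -> S `<=` tau -> tau (soft_bigcap S) }.

Definition soft_separation {X E : Type} (tau : set (soft_set X E))
    (F G : soft_set X E) : Prop :=
  [/\ tau F /\ tau G, F <> soft_null /\ G <> soft_null,
      soft_setU F G = soft_full & soft_setI F G = soft_null].

Definition soft_connected {X E : Type} (tau : set (soft_set X E)) : Prop :=
  ~ exists F G : soft_set X E, soft_separation tau F G.

Section SoftMapping.
Context {U V A B : Type} (u : U -> V) (p : A -> B).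

Definition soft_image (F : soft_set U A) : soft_set V B :=
  fun y => \bigcup_(x in p @^-1` [set y]) (u @` F x).

Definition soft_preimage (G : soft_set V B) : soft_set U A :=
  fun x => u @^-1` (G (p x)).

Definition soft_continuous (tau : set (soft_set U A))
    (tau' : set (soft_set V B)) : Prop :=
  forall G : soft_set V B, tau' G -> tau (soft_preimage G).

End SoftMapping.

(* Main.v *)
(** A preimage of [soft_full] under the surjective soft image map meets the
    fibre over every point of every parameter, so soft preimages of non-null
    soft sets are non-null. Soft preimages also commute with union and
    intersection, so a soft separation of the codomain pulls back to one of
    the domain. *)
Require Import Defs.
From mathcomp Require Import all_boot.
From mathcomp Require Import boolp classical_sets functions cardinality.
Local Open Scope classical_set_scope.

Lemma soft_preimage_eq_null (U V A B : Type) (u : U -> V) (p : A -> B)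
    (G : soft_set V B) :
  set_surj [set: soft_set U A] [set: soft_set V B] (soft_image u p) ->
  soft_preimage u p G = soft_null -> G = soft_null.
Proof.
move=> surj G0; apply/funext => b; rewrite -subset0 => v Gbv.
(* Take [F] with image [soft_full]: since [v] lies in that image at [b], there are a parameter [a]
   with [p a = b] and a point [x] with [u x = v]. *)
have [F _ Ffull] := surj soft_full I.
have : soft_image u p F b v by rewrite Ffull.
move=> [a /= pab [x _ uxv]].
have : soft_preimage u p G a x by rewrite /soft_preimage /= pab uxv.
by rewrite G0.
Qed.

Theorem theorem2p8 (U V A B : Type)
  (tau : set (soft_set U A)) (tau' : set (soft_set V B))
  (htau : soft_topology tau) (htau' : soft_topology tau')
  (u : U -> V) (p : A -> B)
  (hsurj : set_surj [set: soft_set U A] [set: soft_set V B] (soft_image u p))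
  (hcont : soft_continuous u p tau tau')
  (hconn : soft_connected tau) :
  soft_connected tau'.
Proof.
move=> [F [G [[oF oG] [F0 G0] FUG FIG]]]; apply: hconn.
exists (soft_preimage u p F), (soft_preimage u p G); split.
- by split; apply: hcont.
- by split=> /(soft_preimage_eq_null _ _ _ _ _ _ _ hsurj).
(* Preimages commute with union, and with intersection in the next case, by mere conversion, so
   pulling the equation back along [u] at the parameter [p a] already gives the goal at [a]. *)
- by apply/funext => a; exact: (congr1 (fun H => u @^-1` H (p a)) FUG).
- by apply/funext => a; exact: (congr1 (fun H => u @^-1` H (p a)) FIG).
Qed.
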